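(* $(\mathcal{BD}^1_g([a,b]),d)$ is a complete metric space.
   Context: Let $a<b$ be real numbers and let $g:\mathbb{R}\to\mathbb{R}$ be non-decreasing and left-continuous (a ''derivator''). Put $\Delta g(t)=g(t^+)-g(t)$, $D_g=\{t\in\mathbb{R}:\Delta g(t)>0\}$, and $C_g=\{t\in\mathbb{R}: g \text{ is constant on } (t-\varepsilon,t+\varepsilon)\text{ for some }\varepsilon>0\}$. The set $C_g$ is open; write $C_g=\bigcup_n (a_n,b_n)$ with $(a_n,b_n)$ its (pairwise disjoint) connected components. Put $N_g^-=\{a_n\}_n\setminus D_g$, $N_g^+=\{b_n\}_n\setminus D_g$, $N_g=N_g^-\cup N_g^+$. Standing assumption: $a\notin N_g^-$ and $b\notin N_g^+\cup D_g\cup C_g$. $g$-derivative: for $f:[a,b]\to\mathbb{R}$ and $t\in[a,b]$, $f'_g(t)=\lim_{s\to t}\frac{f(s)-f(t)}{g(s)-g(t)}$ if $t\notin D_g\cup C_g$; $f'_g(t)=\lim_{s\to t^+}\frac{f(s)-f(t)}{g(s)-g(t)}$ if $t\in D_g$; $f'_g(t)=\lim_{s\to b_n^+}\frac{f(s)-f(b_n)}{g(s)-g(b_n)}$ if $t\in(a_n,b_n)\subset C_g$; provided the limit exists (and is finite). Limits are taken over those $s\in[a,b]$ for which the denominator is nonzero. $f$ is $g$-continuous at $t\in[a,b]$ if for every $\varepsilon>0$ there is $\delta>0$ with $|f(t)-f(s)|<\varepsilon$ for all $s\in[a,b]$ with $|g(t)-g(s)|<\delta$. It is left (resp. right) $g$-continuous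 at $t$ if for every $\varepsilon>0$ there is $\delta>0$ such that $|f(s)-f(t)|<\varepsilon$ for all $s\in[a,b]$ with $s<t$ and $g(t)-g(s)<\delta$ (resp. $s>t$ and $g(s)-g(t)<\delta$). $\mathcal{BD}_g([a,b])$ is the set of bounded $f:[a,b]\to\mathbb{R}$ that are $g$-continuous at every point of $[a,b]\setminus(C_g\cup N_g\cup D_g)$, left $g$-continuous at every point of $N_g^-\cap[a,b]$ and right $g$-continuous at every point of $N_g^+\cap[a,b]$. $\mathcal{BD}^1_g([a,b])$ is the set of $f\in\mathcal{BD}_g([a,b])$ such that $f'_g(t)$ exists for all $t\in[a,b]$ and $f'_g\in\mathcal{BD}_g([a,b])$. For $x,y\in\mathbb{R}$ let $l(x,y)=\frac{|x-y|}{\sqrt{1+x^2}\sqrt{1+y^2}}$. For $f,h\in\mathcal{BD}^1_g([a,b])$ let $$\Gamma(f,h)=\sup_{\substack{s,t\in[a,b]\\ g(s)\ne g(t)}} l\left(\frac{f(s)-f(t)}{g(s)-g(t)},\frac{h(s)-h(t)}{g(s)-g(t)}\right),\qquad d(f,h)=\|f-h\|_\infty+\|f'_g-h'_g\|_\infty+\Gamma(f,h),$$ where $\|\cdot\|_\infty$ is the supremum norm on $[a,b]$. *)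

(* Defs.v *)
From HB Require Import structures.
From mathcomp Require Export all_boot all_order all_algebra.
From mathcomp Require Export all_classical all_reals all_analysis.
Set Implicit Arguments.
Unset Strict Implicit.
Unset Printing Implicit Defensive.
Export Order.TTheory GRing.Theory Num.Theory.
Export numFieldNormedType.Exports.

Local Open Scope classical_set_scope.
Local Open Scope ring_scope.

Section Derivator.
Context {R : realType} (g : R -> R).

Definition derivator : Prop :=
  {homo g : x y / x <= y} /\ (forall t, g x @[x --> t^'-] --> g t).

Definition gjump (t : R) : R := lim (g x @[x --> t^'+]) - g t.

Definition Dg : set R := [set t | 0 < gjump t].

Definition Cg : set R :=
  [set t | exists2 e : R, 0 < e & {in `]t - e, t + e[ &, forall x y, g x = g y}].

(* For [t] in [Cg], the endpoints of the component of [Cg] containing [t];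
   they are infinite when the component is unbounded, and only the finite ones
   belong to the sets [{a_n}] and [{b_n}]. *)
Definition comp_inf (t : R) : \bar R :=
  ereal_inf (EFin @` connected_component Cg t).
Definition comp_sup (t : R) : \bar R :=
  ereal_sup (EFin @` connected_component Cg t).

Definition Nminus : set R :=
  [set x | exists2 t, Cg t & x%:E = comp_inf t] `\` Dg.
Definition Nplus : set R :=
  [set x | exists2 t, Cg t & x%:E = comp_sup t] `\` Dg.
Definition Ng : set R := Nminus `|` Nplus.

End Derivator.

Section BDg.
Context {R : realType} (g : R -> R) {a b : R}.
Local Notation I := (set_type `[a, b]%classic).
Implicit Types (f h : I -> R) (s t : I).

Definition quot f s t : R := (f s - f t) / (g (\val s) - g (\val t)).

(* The point at which the difference quotients defining [f'_g(t)] are based: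
   [b_n] for [t] in [(a_n, b_n)], and [t] itself otherwise.  When [b] satisfies
   the standing assumption, [b_n] is finite and lies in [a, b], so that the
   default values of [fine] and [insubd] are not used. *)
Definition base t : I :=
  if \val t \in Cg g then insubd t (fine (comp_sup g (\val t))) else t.

Definition gder_filter t : set_system I :=
  if \val t \in Cg g `|` Dg g then
    within [set s | \val (base t) < \val s /\ g (\val s) != g (\val (base t))]
      (nbhs (base t))
  else within [set s | g (\val s) != g (\val t)] (nbhs t).

Definition gderivable f t : Prop :=
  cvg (quot f s (base t) @[s --> gder_filter t]).

Definition gderive f t : R :=
  lim (quot f s (base t) @[s --> gder_filter t]).

Definition gcontinuous_at f t : Prop :=
  forall e : R, 0 < e -> exists2 d : R, 0 < d &
    forall s, `|g (\val t) - g (\val s)| < d -> `|f t - f s| < e.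

Definition left_gcontinuous_at f t : Prop :=
  forall e : R, 0 < e -> exists2 d : R, 0 < d &
    forall s, \val s < \val t -> g (\val t) - g (\val s) < d ->
      `|f s - f t| < e.

Definition right_gcontinuous_at f t : Prop :=
  forall e : R, 0 < e -> exists2 d : R, 0 < d &
    forall s, \val t < \val s -> g (\val s) - g (\val t) < d ->
      `|f s - f t| < e.

Definition BD : set (I -> R) := [set f |
  [/\ bounded_fun f,
      forall t, ~ (Cg g `|` Ng g `|` Dg g) (\val t) -> gcontinuous_at f t,
      forall t, Nminus g (\val t) -> left_gcontinuous_at f t &
      forall t, Nplus g (\val t) -> right_gcontinuous_at f t]].

Definition BD1 : set (I -> R) := [set f |
  [/\ BD f, forall t, gderivable f t & BD (gderive f)]].

Definition chordal (x y : R) : R :=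
  `|x - y| / (Num.sqrt (1 + x ^+ 2) * Num.sqrt (1 + y ^+ 2)).

(* [sup] is real-valued; the sets below are bounded for [f] and [h] in [BD1]
   (note that [chordal x y <= 1]), so its default value is not used. *)
Definition supnorm f : R := sup [set `|f t| | t in [set: I]].

Definition Gamma f h : R :=
  sup [set chordal (quot f p.1 p.2) (quot h p.1 p.2) |
        p in [set p : I * I | g (\val p.1) != g (\val p.2)]].

Definition dist1 f h : R :=
  supnorm (f \- h) + supnorm (gderive f \- gderive h) + Gamma f h.

End BDg.

(* Main.v *)
From HB Require Import structures.
Require Import Defs.
From mathcomp Require Import ring lra.

(** Most of the metric axioms are inherited from the supremum norm and from the
chordal distance [l].  The latter is a distance: to a real [x] attach the unit
vector [(1, x) / sqrt (1 + x ^+ 2)] of the plane; then [l x y] is the sine of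
the angle between the lines spanned by two such vectors, and the addition
formula for the sine gives the triangle inequality ([chordal_triangle]).
Besides, [l x y <= |x - y|], and conversely convergence for [l] to a real
number is ordinary convergence ([dist_lt_of_chordal]), so that [l] induces the
usual topology although it gives the line diameter at most [1].  This is the
reason for measuring difference quotients with [l]: the quotients of a function
of [BD1] need not be bounded, but the supremum [Gamma] is always finite.

For completeness, a Cauchy sequence [v n] converges uniformly to some [f], and
its derivatives converge uniformly to some [f'].  Both limits belong to [BD],
since each of its conditions is stable under uniform limits ([BD_closed]).  The
point is that [f'] is the derivative of [f], which the uniform convergence of
the derivatives alone does not give.  The term [Gamma] does: passing to the
limit in [m] in the bound for [Gamma (v n) (v m)] shows that the difference
quotients of [v n] approach those of [f] for [l], uniformly over all pairs of
points.  The limit of the quotients at a point and the limit in [n] may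
therefore be exchanged ([cvg_of_chordal_approx]).  The same bound says that
[Gamma (v n) f] tends to [0]. *)

Set Implicit Arguments.
Unset Strict Implicit.
Unset Printing Implicit Defensive.

Local Open Scope classical_set_scope.
Local Open Scope ring_scope.

(** * The chordal distance on the real line *)

Section chordal_distance.
Context {R : realType}.
Implicit Types x y z : R.

(* The norm of the vector [(1, x)]. *)
Let c x : R := Num.sqrt (1 + x ^+ 2).

Let sqr_c x : c x ^+ 2 = 1 + x ^+ 2.
Proof. by rewrite sqr_sqrtr// addr_ge0// sqr_ge0. Qed.

Let c_gt0 x : 0 < c x.
Proof. by rewrite sqrtr_gt0 ltr_pwDl// sqr_ge0. Qed.

Let c_ge0 x : 0 <= c x.
Proof. exact: ltW. Qed.

Let c_ge1 x : 1 <= c x.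
Proof.
by rewrite -[1]sqrtr1 ler_wsqrtr// lerDl sqr_ge0.
Qed.

Lemma chordal_ge0 x y : 0 <= chordal x y.
Proof. by rewrite divr_ge0// mulr_ge0// sqrtr_ge0. Qed.

Lemma chordalxx x : chordal x x = 0.
Proof. by rewrite /chordal subrr normr0 mul0r. Qed.

Lemma chordalC x y : chordal x y = chordal y x.
Proof. by rewrite /chordal distrC [X in _ / X]mulrC. Qed.

Let normr_le_sqr (w d : R) : 0 <= d -> w ^+ 2 <= d ^+ 2 -> `|w| <= d.
Proof.
move=> d0 wd; rewrite -ler_sqr ?nnegrE//.
by rewrite real_normK// num_real.
Qed.

(** The determinant of two plane vectors is at most the product of their norms;
by Lagrange's identity the difference of the squares is [(1 + x * y) ^+ 2]. *)
Lemma chordal_le1 x y : chordal x y <= 1.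
Proof.
rewrite ler_pdivrMr ?mul1r ?mulr_gt0 ?c_gt0//; apply: normr_le_sqr.
  by rewrite mulr_ge0// sqrtr_ge0.
rewrite exprMn !sqr_c; have := sqr_ge0 (1 + x * y); lra.
Qed.

(** The formula [sin (u + v) = sin u * cos v + cos u * sin v], in which the
cosines are bounded by [1].  Cleared of denominators it is the identity
[(x - z) (1 + y ^+ 2) = (x - y) (1 + y z) + (y - z) (1 + x y)], and the bound on
the cosines is the Cauchy-Schwarz inequality [cs]. *)
Lemma chordal_triangle y x z : chordal x z <= chordal x y + chordal y z.
Proof.
have cs w v : `|1 + w * v| <= c w * c v.
  apply: normr_le_sqr; first by rewrite mulr_ge0// ltW.
  rewrite exprMn !sqr_c; have := sqr_ge0 (w - v); lra.
rewrite /chordal -!/(c _) ler_pdivrMr ?mulr_gt0//.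
have -> : (`|x - y| / (c x * c y) + `|y - z| / (c y * c z)) * (c x * c z) =
    (`|x - y| * c z + `|y - z| * c x) / c y.
  by field; rewrite !gt_eqF.
rewrite ler_pdivlMr// -(@ler_pM2r _ (c y))// -mulrA -expr2.
have -> : `|x - z| * c y ^+ 2 = `|(x - y) * (1 + y * z) + (y - z) * (1 + x * y)|.
  by rewrite -[c y ^+ 2]ger0_norm ?sqr_ge0// -normrM sqr_c; congr `|_|; ring.
apply: le_trans (ler_normD _ _) _; rewrite !normrM mulrDl lerD//.
  by rewrite -mulrA ler_wpM2l// mulrC cs.
by rewrite -mulrA ler_wpM2l// cs.
Qed.

Lemma chordal_le_dist x y : chordal x y <= `|x - y|.
Proof.
by rewrite /chordal -!/(c _) ler_pdivrMr ?mulr_gt0// ler_peMr// mulr_ege1.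
Qed.

(** Near a finite point the chordal distance controls the usual one: the factor
[c x] of the denominator, which could be large, is at most [c y + |x - y|]. *)
Lemma dist_lt_of_chordal y (e : R) : 0 < e ->
  exists2 d : R, 0 < d & forall x, chordal x y < d -> `|x - y| < e.
Proof.
move=> e0; have cy := c_gt0 y.
(* If [|x - y| = D >= e], then [D < d * c x * c y <= d * c y * (c y + D)];
   as [D / (c y + D)] increases with [D], it suffices that
   [d * c y * (c y + e) < e], and this [d] leaves a factor [2]. *)
exists (e / (2 * c y * (c y + e))); first by rewrite divr_gt0 ?mulr_gt0 ?addr_gt0.
move=> x; rewrite /chordal -!/(c _) ltr_pdivrMr ?mulr_gt0//.
set D := `|x - y| => hD; rewrite ltNge; apply/negP => eD.
have D0 : 0 <= D by exact: normr_ge0.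
have cxy : c x <= c y + D.
  rewrite -ler_sqr ?nnegrE ?(addr_ge0 _ D0)// sqr_c sqrrD sqr_c.
  have -> : D ^+ 2 = (x - y) ^+ 2 by rewrite real_normK ?num_real.
  have yc : `|y| <= c y.
    by apply: normr_le_sqr => //; rewrite sqr_c lerDr.
  have : y * (x - y) <= c y * D.
    by rewrite (le_trans (ler_norm _))// normrM ler_wpM2r.
  by rewrite mulr2n; lra.
have : D * (2 * (c y + e)) < e * c x.
  have -> : e * c x = e / (2 * c y * (c y + e)) * (c x * c y) * (2 * (c y + e)).
    by field; rewrite !gt_eqF// addr_gt0.
  by rewrite ltr_pM2r// mulr_gt0// addr_gt0.
have : e * c x <= e * (c y + D) by rewrite ler_pM2l.
nra.
Qed.

End chordal_distance.

(** * Suprema of families and uniform limits *)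

Section sup_family.
Context {R : realType} {T : Type}.
Implicit Types (F : T -> R) (A : set T).

(** The bound [0 <= c] covers the empty family, whose supremum is [0]. *)
Lemma sup_family_le F A c :
  0 <= c -> (forall x, A x -> F x <= c) -> sup [set F x | x in A] <= c.
Proof.
move=> c0 Fc; have [->|A0] := eqVneq A set0; first by rewrite image_set0 sup0.
apply: ge_sup; first by apply/image_nonempty; exact/set0P.
by move=> _ [x Ax <-]; exact: Fc.
Qed.

Lemma le_sup_family F A c x :
  (forall x, A x -> F x <= c) -> A x -> F x <= sup [set F x | x in A].
Proof.
move=> Fc Ax; apply: ub_le_sup; last by exists x.
by exists c => _ [y Ay <-]; exact: Fc.
Qed.

Lemma sup_family_ge0 F A c : (forall x, A x -> F x <= c) ->
  (forall x, A x -> 0 <= F x) -> 0 <= sup [set F x | x in A].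
Proof.
move=> Fc F0; have [->|/set0P[x Ax]] := eqVneq A set0.
  by rewrite image_set0 sup0.
exact: le_trans (F0 x Ax) (le_sup_family Fc Ax).
Qed.

End sup_family.

Section uniform_limits.
Context {R : realType} {T : Type}.

Definition unif_cvg (v : nat -> T -> R) (w : T -> R) : Prop :=
  forall e : R, 0 < e ->
    exists N, forall n t, (N <= n)%N -> `|v n t - w t| <= e.

Definition unif_cauchy (v : nat -> T -> R) : Prop :=
  forall e : R, 0 < e ->
    exists N, forall n m t, (N <= n)%N -> (N <= m)%N -> `|v n t - v m t| <= e.

Lemma unif_cauchy_cvg v : unif_cauchy v -> exists w, unif_cvg v w.
Proof.
move=> vC.
have cv t : cvgn (v ^~ t).
  apply/cauchy_cvgP/cauchy_ballP => e e0.
  have [N HN] := vC _ (divr_gt0 e0 (ltr0n R 2)).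
  pose tail := v ^~ t @` [set n | (N <= n)%N].
  have tailP : \forall n \near \oo, tail (v n t) by exists N => // n; exists n.
  exists (tail, tail) => // -[_ _] [[n Nn <-] [m Nm <-]]; rewrite /ball/=.
  by rewrite (le_lt_trans (HN _ _ _ Nn Nm))// gtr_pMr// invf_lt1// ltr1n.
exists (fun t => limn (v ^~ t)) => e e0.
have [N HN] := vC _ e0; exists N => n t Nn.
have vnt : `|v n t - v m t| @[m --> \oo] --> `|v n t - limn (v ^~ t)|.
  by apply: cvg_norm; apply: cvgB; [exact: cvg_cst|exact: cv].
apply: cvgr_to_le vnt _.
by exists N => // m Nm; exact: HN.
Qed.

Lemma unif_cvg_pointwise v w t : unif_cvg v w -> v ^~ t @ \oo --> w t.
Proof.
move=> vw; apply/cvgrPdist_le => e e0; have [N HN] := vw _ e0.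
by exists N => // n Nn; rewrite distrC; exact: HN.
Qed.

Lemma bounded_funP (f : T -> R) :
  bounded_fun f <-> exists M, forall t, `|f t| <= M.
Proof.
split=> [[M [_ fM]]|[M fM]].
  by exists (M + 1) => t; apply: fM => //; rewrite ltrDl.
exists M; split; first exact: num_real.
by move=> x Mx t _; exact: le_trans (fM t) (ltW Mx).
Qed.

Lemma unif_cvg_bounded v w :
  unif_cvg v w -> (forall n, bounded_fun (v n)) -> bounded_fun w.
Proof.
move=> vw vb; have [N HN] := vw _ ltr01.
have /bounded_funP[M HM] := vb N; apply/bounded_funP; exists (M + 1) => t.
rewrite -(subKr (v N t) (w t)) (le_trans (ler_normB _ _))// lerD//.
exact: HN.
Qed.

(** The common part of the stability of every kind of continuity under uniform
limits: the increments of the limit are controlled by those of a single term of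
the sequence, uniformly over the points. *)
Lemma unif_cvg_approx v w (e : R) : unif_cvg v w -> 0 < e ->
  exists n, forall s t, `|v n s - v n t| < e / 2 -> `|w s - w t| < e.
Proof.
move=> vw e0; have [N HN] := vw _ (divr_gt0 e0 (ltr0n R 4)).
exists N => s t; have := HN N s (leqnn N); have := HN N t (leqnn N).
rewrite !ler_norml !ltr_norml; lra.
Qed.

End uniform_limits.

(** * Exchanging limits of difference quotients *)

Lemma chordal_limit_le {R : realType} (q : nat -> R) (l c e : R) : q @ \oo --> l ->
  (\forall n \near \oo, chordal c (q n) <= e) -> chordal c l <= e.
Proof.
move=> ql qe; apply/ler_addgt0Pr => d d0.
near \oo => n.
have h1 : chordal c (q n) <= e by near: n.
have h2 : `|q n - l| <= d.
  by rewrite distrC; near: n; move/cvgrPdist_le: ql; exact.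
have h3 := chordal_triangle (q n) c l.
have h4 := chordal_le_dist (q n) l.
lra.
Unshelve. all: by end_near. Qed.

(** Exchange of limits with the approximation of [p] by the functions [q n]
measured by the chordal distance only.  Since [k] is finite, chordal closeness
to [k] is still enough for convergence in the usual sense, even though [p] and
[q n] need not be close for the usual distance at the points where they are
large. *)
Lemma cvg_of_chordal_approx {R : realType} {T : Type} (F : set_system T)
    (q : nat -> T -> R) (p : T -> R) (l : nat -> R) (k : R) : Filter F ->
    (forall n, q n @ F --> l n) -> l @ \oo --> k ->
    (forall e, 0 < e -> \forall n \near \oo,
       \forall s \near F, chordal (p s) (q n s) <= e) ->
  p @ F --> k.
Proof.
move=> FF ql lk pq; apply/cvgrPdist_lt => e e0.
have [d d0 Hd] := dist_lt_of_chordal k e0.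
have d3 : 0 < d / 4 by rewrite divr_gt0.
near \oo => n.
have Fpq : \forall s \near F, chordal (p s) (q n s) <= d / 4.
  by near: n; exact: pq.
have nk : `|k - l n| < d / 4 by near: n; move/cvgrPdist_lt: lk; exact.
have Fql : \forall s \near F, `|l n - q n s| < d / 4.
  by move/cvgrPdist_lt: (ql n); exact.
apply: filterS2 Fpq Fql => s h1 h2; rewrite distrC; apply: Hd.
have h3 := chordal_triangle (q n s) (p s) k.
have h4 := chordal_triangle (l n) (q n s) k.
have h5 := chordal_le_dist (q n s) (l n).
have h6 := chordal_le_dist (l n) k.
rewrite distrC in h2; rewrite distrC in nk; lra.
Unshelve. all: by end_near. Qed.

(** * Functions on the interval *)

Section BD1_metric.
Context {R : realType} (g : R -> R) {a b : R}.
Local Notation I := (set_type `[a, b]%classic).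
Implicit Types (f h : I -> R) (s t : I).

Lemma BD_bounded f : BD g f -> bounded_fun f.
Proof. by case. Qed.

Lemma BD_closed (v : nat -> I -> R) (w : I -> R) :
  unif_cvg v w -> (forall n, BD g (v n)) -> BD g w.
Proof.
move=> vw vBD; split.
- by apply: unif_cvg_bounded vw _ => n; exact: BD_bounded.
- move=> t tC e e0; have [n Hn] := unif_cvg_approx vw e0.
  have [_ /(_ t tC)/(_ _ (divr_gt0 e0 (ltr0n R 2)))[d d0 Hd] _ _] := vBD n.
  by exists d => // s ts; apply: Hn; exact: Hd.
- move=> t tC e e0; have [n Hn] := unif_cvg_approx vw e0.
  have [_ _ /(_ t tC)/(_ _ (divr_gt0 e0 (ltr0n R 2)))[d d0 Hd] _] := vBD n.
  by exists d => // s st ts; apply: Hn; exact: Hd.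
- move=> t tC e e0; have [n Hn] := unif_cvg_approx vw e0.
  have [_ _ _ /(_ t tC)/(_ _ (divr_gt0 e0 (ltr0n R 2)))[d d0 Hd]] := vBD n.
  by exists d => // s st ts; apply: Hn; exact: Hd.
Qed.

Instance gder_filter_filter t : Filter (gder_filter g t).
Proof. by rewrite /gder_filter; case: ifP => _; exact: within_filter. Qed.

(** The difference quotients defining the derivative are among those entering
the supremum [Gamma]. *)
Lemma gder_filter_neq t : \forall s \near gder_filter g t,
  g (\val s) != g (\val (base g t)).
Proof.
rewrite /gder_filter /base; case: ifPn => [_|].
  by apply: filterS (near_withinT _ _) => s [].
by rewrite in_setU negb_or => /andP[/negbTE -> _]; exact: near_withinT.
Qed.

Lemma gderive_cvg f t : gderivable g f t ->
  quot g f s (base g t) @[s --> gder_filter g t] --> gderive g f t.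
Proof. by []. Qed.

(** Along the trivial filter a function converges to every number, so that
convergence to [k] says nothing about the value chosen by [lim].  That value is
then the same for all functions, hence it is the limit [k] of the derivatives
[gderive g (h n) t].  Derivatives are identified in this way without examining
how the points where [g] differs from [g (base t)] accumulate. *)
Lemma cvg_gderive f (h : nat -> I -> R) t (k : R) :
  gderive g (h n) t @[n --> \oo] --> k ->
  quot g f s (base g t) @[s --> gder_filter g t] --> k ->
  gderive g f t = k.
Proof.
move=> hk fk.
have [F0|F0] := pselect (gder_filter g t set0); last first.
  have PF : ProperFilter (gder_filter g t) by exact: Build_ProperFilter.
  exact: cvg_lim fk.
have Fall (A : set I) : gder_filter g t A by apply: filterS F0.
have E n : gderive g (h n) t = gderive g f t.
  suff EF : quot g (h n) s (base g t) @[s --> gder_filter g t] =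
      quot g f s (base g t) @[s --> gder_filter g t] by rewrite /gderive EF.
  by apply/seteqP; split => A _; exact: Fall.
move: hk; under eq_fun do rewrite E.
by move=> /cvg_lim <-//; rewrite lim_cst.
Qed.

Lemma chordal_quot_le1 f h (p : I * I) :
  [set p : I * I | g (\val p.1) != g (\val p.2)] p ->
  chordal (quot g f p.1 p.2) (quot g h p.1 p.2) <= 1.
Proof. by move=> _; exact: chordal_le1. Qed.

Lemma Gamma_ge0 f h : 0 <= Gamma g f h.
Proof.
by apply: sup_family_ge0 (@chordal_quot_le1 f h) _ => p _; exact: chordal_ge0.
Qed.

Lemma chordal_le_Gamma f h s t : g (\val s) != g (\val t) ->
  chordal (quot g f s t) (quot g h s t) <= Gamma g f h.
Proof.
by move=> st; exact: (@le_sup_family _ _ _ _ _ (s, t) (@chordal_quot_le1 f h)).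
Qed.

Lemma Gamma_le f h c : 0 <= c ->
  (forall s t, g (\val s) != g (\val t) ->
    chordal (quot g f s t) (quot g h s t) <= c) ->
  Gamma g f h <= c.
Proof. by move=> c0 Hc; apply: sup_family_le => // -[s t]; exact: Hc. Qed.

Lemma bounded_funB f h :
  bounded_fun f -> bounded_fun h -> exists M, forall t, `|(f \- h) t| <= M.
Proof.
move=> /bounded_funP[M HM] /bounded_funP[N HN]; exists (M + N) => t /=.
by rewrite (le_trans (ler_normB _ _))// lerD.
Qed.

Lemma normB_le_supnorm f h t :
  bounded_fun f -> bounded_fun h -> `|f t - h t| <= supnorm (f \- h).
Proof.
move=> bf bh; have [M HM] := bounded_funB bf bh.
by apply: (@le_sup_family _ _ (fun t => `|(f \- h) t|) setT M t) => // s _.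
Qed.

Lemma supnorm_ge0 f h : bounded_fun f -> bounded_fun h -> 0 <= supnorm (f \- h).
Proof.
move=> bf bh; have [M HM] := bounded_funB bf bh.
by apply: (@sup_family_ge0 _ _ _ _ M).
Qed.

Lemma supnorm_le f c : 0 <= c -> (forall t, `|f t| <= c) -> supnorm f <= c.
Proof. by move=> c0 fc; apply: sup_family_le => // t _. Qed.

Lemma supnorm_triangle f1 f2 f3 : bounded_fun f1 -> bounded_fun f2 -> bounded_fun f3 ->
  supnorm (f1 \- f3) <= supnorm (f1 \- f2) + supnorm (f2 \- f3).
Proof.
move=> b1 b2 b3; apply: supnorm_le => [|t]; first by rewrite addr_ge0 ?supnorm_ge0.
by rewrite (le_trans (ler_distD (f2 t) _ _))// lerD// normB_le_supnorm.
Qed.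

Lemma supnormC f h : supnorm (f \- h) = supnorm (h \- f).
Proof.
by congr sup; apply/seteqP; split => _ [t _ <-] /=; exists t => //=; rewrite distrC.
Qed.

Lemma supnormxx f : supnorm (f \- f) = 0.
Proof.
apply/eqP; rewrite eq_le supnorm_le//=; last by move=> t; rewrite /= subrr normr0.
by apply: (@sup_family_ge0 _ _ _ _ 0) => t _ //=; rewrite subrr normr0.
Qed.

Lemma Gamma_triangle f1 f2 f3 :
  Gamma g f1 f3 <= Gamma g f1 f2 + Gamma g f2 f3.
Proof.
apply: Gamma_le => [|s t st]; first by rewrite addr_ge0 ?Gamma_ge0.
rewrite (le_trans (chordal_triangle (quot g f2 s t) _ _))//.
by rewrite lerD// chordal_le_Gamma.
Qed.

Lemma GammaC f h : Gamma g f h = Gamma g h f.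
Proof.
by congr sup; apply/seteqP; split => _ [p pP <-] /=; exists p => //; rewrite chordalC.
Qed.

Lemma Gammaxx f : Gamma g f f = 0.
Proof.
apply/eqP; rewrite eq_le Gamma_ge0 andbT.
by apply: Gamma_le => // s t _; rewrite chordalxx.
Qed.

(** * The metric space *)

(** A name for the carrier, for the metric structure to be attached to. *)
Definition bd1 : Type := set_type (@BD1 R g a b).

Implicit Types x y z : bd1.

Lemma bd1_bounded x : bounded_fun (\val x).
Proof. by have [[]] := set_valP x. Qed.

Lemma bd1_gderive_bounded x : bounded_fun (gderive g (\val x)).
Proof. by have [_ _ []] := set_valP x. Qed.

Definition bd1_dist x y : R := dist1 g (\val x) (\val y).

Lemma bd1_distxx x : bd1_dist x x = 0.
Proof. by rewrite /bd1_dist /dist1 !supnormxx Gammaxx !addr0. Qed.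

Lemma supnorm_le_bd1_dist x y : supnorm (\val x \- \val y) <= bd1_dist x y.
Proof.
rewrite /bd1_dist /dist1 -addrA lerDl addr_ge0 ?Gamma_ge0// supnorm_ge0//;
  exact: bd1_gderive_bounded.
Qed.

Lemma supnorm_gderive_le_bd1_dist x y :
  supnorm (gderive g (\val x) \- gderive g (\val y)) <= bd1_dist x y.
Proof.
rewrite /bd1_dist /dist1 addrAC lerDr addr_ge0 ?Gamma_ge0// supnorm_ge0//;
  exact: bd1_bounded.
Qed.

Lemma Gamma_le_bd1_dist x y : Gamma g (\val x) (\val y) <= bd1_dist x y.
Proof.
rewrite /bd1_dist /dist1 lerDr addr_ge0// supnorm_ge0//;
  by do ?[exact: bd1_bounded|exact: bd1_gderive_bounded].
Qed.

Lemma bd1_dist_eq0 x y : bd1_dist x y = 0 -> x = y.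
Proof.
move=> d0; apply/val_inj/funext => t; apply/eqP; rewrite -subr_eq0 -normr_le0.
rewrite -d0 (le_trans _ (supnorm_le_bd1_dist x y))//.
by apply: normB_le_supnorm; exact: bd1_bounded.
Qed.

Lemma bd1_distC x y : bd1_dist x y = bd1_dist y x.
Proof.
rewrite /bd1_dist /dist1; congr (_ + _ + _); [exact: supnormC|exact: supnormC|].
exact: GammaC.
Qed.

Lemma bd1_dist_triangle y x z : bd1_dist x z <= bd1_dist x y + bd1_dist y z.
Proof.
have := supnorm_triangle (bd1_bounded x) (bd1_bounded y) (bd1_bounded z).
have := supnorm_triangle (bd1_gderive_bounded x) (bd1_gderive_bounded y)
  (bd1_gderive_bounded z).
have := Gamma_triangle (\val x) (\val y) (\val z).
by rewrite /bd1_dist /dist1; lra.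
Qed.

HB.instance Definition _ := Choice.on bd1.
HB.instance Definition _ := @isMetric.Build R bd1 bd1_dist
  bd1_distxx bd1_dist_eq0 bd1_distC bd1_dist_triangle.

Lemma quot_cvg (v : nat -> I -> R) f s t :
  unif_cvg v f -> quot g (v n) s t @[n --> \oo] --> quot g f s t.
Proof.
move=> vf; apply: cvgMl; apply: cvgB; exact: unif_cvg_pointwise.
Qed.

(** A Cauchy sequence for the distance is uniformly Cauchy, together with its
derivatives and, for the chordal distance, its difference quotients. *)
Lemma bd1_complete (u : nat -> bd1) :
  cauchy (u n @[n --> \oo]) -> exists x : bd1, u n @[n --> \oo] --> x.
Proof.
move=> /cauchyP uC.
have {}uC e : 0 < e -> exists N, forall n m, (N <= n)%N -> (N <= m)%N ->
    bd1_dist (u n) (u m) <= e.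
  move=> e0; have /uC[x] : 0 < e / 2 by rewrite divr_gt0.
  rewrite ballEmdist => -[N _ HN]; exists N => n m Nn Nm.
  have h1 : bd1_dist x (u n) < e / 2 by exact: HN.
  have h2 : bd1_dist x (u m) < e / 2 by exact: HN.
  have := bd1_dist_triangle x (u n) (u m).
  rewrite (bd1_distC _ x); lra.
pose v n := \val (u n); pose v' n := gderive g (v n).
have [f vf] : exists f, unif_cvg v f.
  apply: unif_cauchy_cvg => e /uC[N HN]; exists N => n m t Nn Nm.
  rewrite (le_trans _ (HN _ _ Nn Nm))// (le_trans _ (supnorm_le_bd1_dist _ _))//.
  by apply: normB_le_supnorm; exact: bd1_bounded.
have [f' vf'] : exists f', unif_cvg v' f'.
  apply: unif_cauchy_cvg => e /uC[N HN]; exists N => n m t Nn Nm.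
  rewrite (le_trans _ (HN _ _ Nn Nm))//.
  rewrite (le_trans _ (supnorm_gderive_le_bd1_dist _ _))//.
  by apply: normB_le_supnorm; exact: bd1_gderive_bounded.
(* Let [m] tend to infinity in the Cauchy condition for [Gamma (v n) (v m)]:
   the rank [N] is independent of [s] and [t]. *)
have vfG (e : R) : 0 < e -> exists N, forall n s t, (N <= n)%N ->
    g (\val s) != g (\val t) -> chordal (quot g (v n) s t) (quot g f s t) <= e.
  move=> /uC[N HN]; exists N => n s t Nn st.
  apply: chordal_limit_le (quot_cvg (s := s) (t := t) vf) _; exists N => // m Nm.
  rewrite (le_trans _ (HN _ _ Nn Nm))// (le_trans _ (Gamma_le_bd1_dist _ _))//.
  exact: chordal_le_Gamma.
have ff' t : quot g f s (base g t) @[s --> gder_filter g t] --> f' t.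
  apply: (@cvg_of_chordal_approx _ _ _ (fun n s => quot g (v n) s (base g t)) _ (v' ^~ t)).
  - by move=> n; apply: gderive_cvg; have [_ + _] := set_valP (u n); exact.
  - exact: unif_cvg_pointwise vf'.
  - move=> e /vfG[N HN]; exists N => // n Nn.
    apply: filterS (gder_filter_neq t) => s st.
    by rewrite chordalC; exact: HN.
have ff'E : gderive g f = f'.
  apply/funext => t; apply: (@cvg_gderive _ v); last exact: ff'.
  exact: unif_cvg_pointwise vf'.
have fBD : BD1 g f.
  split.
  - by apply: BD_closed vf _ => n; have [] := set_valP (u n).
  - by move=> t; apply/cvg_ex; exists (f' t); exact: ff'.
  - by rewrite ff'E; apply: BD_closed vf' _ => n; have [] := set_valP (u n).
pose x : bd1 := SigSub (mem_set fBD).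
exists x; apply/cvg_ballP => e e0.
have e4 : 0 < e / 4 by rewrite divr_gt0.
have [N1 H1] := vf _ e4; have [N2 H2] := vf' _ e4; have [N3 H3] := vfG _ e4.
near=> n; rewrite ballEmdist /= -[mdist _ _]/(bd1_dist x (u n)) bd1_distC.
rewrite /bd1_dist /dist1 /= ff'E.
have n1 : supnorm (v n \- f) <= e / 4.
  by apply: supnorm_le (ltW e4) _ => t; apply: H1; near: n; exists N1.
have n2 : supnorm (v' n \- f') <= e / 4.
  by apply: supnorm_le (ltW e4) _ => t; apply: H2; near: n; exists N2.
have n3 : Gamma g (v n) f <= e / 4.
  by apply: Gamma_le (ltW e4) _ => s t; apply: H3; near: n; exists N3.
rewrite -/(v n) -/(v' n); lra.
Unshelve. all: by end_near. Qed.

End BD1_metric.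

Theorem theorem4p22 (R : realType) (g : R -> R) (a b : R)
  (hab : a < b) (hg : derivator g)
  (ha : ~ Nminus g a) (hb : ~ (Nplus g `|` Dg g `|` Cg g) b) :
  exists c : Metric.axioms_ R (set_type (@BD1 R g a b)),
    let M : metricType R := Metric.Pack c in
    (forall f h : set_type (@BD1 R g a b),
      @mdist R M f h = dist1 g (\val f) (\val h)) /\
    (forall u : nat -> M, cauchy (u n @[n --> \oo]) ->
      exists f : M, u n @[n --> \oo] --> f).
Proof.
exists (Metric.class (@bd1 R g a b : metricType R)); split=> //.
exact: bd1_complete.
Qed.
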